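(* Let $n\ge 1$ and $\alpha\ge 1$ be integers. The expected total run length of a word of length $n$ on an alphabet of size $\alpha$ (that is, the average of $TRL(w)$ over all $\alpha^n$ words $w$ of length $n$) is $$\frac{(\alpha -1)^2}{\alpha^2}\sum_{p=1}^{\lfloor (n-2)/2 \rfloor} P(p) \sum_{i=1}^{n-2p-1}\sum_{k=2p}^{n-i-1} k\alpha^{-k}+2\,\frac{\alpha -1}{\alpha}\sum_{p=1}^{\lfloor (n-1)/2 \rfloor} P(p) \sum_{k=2p}^{n-1} k\alpha^{-k} + \frac{n}{\alpha^n}\sum_{p=1}^{\lfloor n/2 \rfloor} P(p),$$ where $P(p)=\sum_{d\mid p}\alpha^d \mu(p/d)$ is the number of primitive words of length $p$ on an alphabet of size $\alpha$ and $\mu$ is the Möbius function.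
   Context: A word of length $n$ is a finite sequence $x=x[1\ldots n]$ of letters from an alphabet; $x[i\ldots j]$ denotes the factor occupying positions $i$ through $j$. A word is primitive if it is not a power, i.e. not a concatenation of two or more copies of a single word. A word has period $p\ge 1$ if $x[i]=x[i+p]$ whenever both positions lie in the word. A run in $x$ is an occurrence of a factor $x[i\ldots j]$ (identified by its pair of positions $(i,j)$) with minimum period $p$, of length $j-i+1\ge 2p$, and such that neither $x[i-1\ldots j]$ nor $x[i\ldots j+1]$ is a factor of $x$ with period $p$ (an extension that leaves the range of positions $1,\dots,n$ is not a factor). The total run length $TRL(w)$ of a word $w$ is the sum of the lengths of all runs in $w$ (runs at different positions are counted separately). Sums whose upper limit is smaller than the lower limit are empty and equal $0$. *)

(* Defs.v *)
From mathcomp Require Import all_boot all_order all_algebra.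

Set Implicit Arguments.
Unset Strict Implicit.
Unset Printing Implicit Defensive.

Import Order.TTheory GRing.Theory Num.Theory.

Section Words.
Variable T : eqType.
Implicit Types x w u : seq T.

Definition is_power w : Prop := exists u k, 1 < k /\ w = flatten (nseq k u).

(* Bounded search over the prefixes [u = take m w] and the exponents
   [2 <= k <= size w + 2]; see [primitiveP]. *)
Definition primitive w : bool :=
  ~~ has (fun k => has (fun m => w == flatten (nseq k (take m w)))
                       (iota 0 (size w).+1))
         (iota 2 (size w).+1).

Lemma primitiveP w : reflect (~ is_power w) (primitive w).
Proof.
apply: (iffP idP) => [/negP prim [u [k [k_gt1 w_uk]]] | npow].
  apply: prim; have szw : size w = k * size u.
    by rewrite w_uk; elim: (k) => //= j IHj; rewrite size_cat IHj.
  have tw : take (size u) w = u.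
    by case: (k) k_gt1 w_uk => // j _ ->; rewrite /= take_size_cat.
  have [u0 | u_gt0] := posnP (size u).
    have w0 : w = [::] by apply: size0nil; rewrite szw u0 muln0.
    by rewrite w0.
  apply/hasP; exists k.
    have le_kw : k <= size w by rewrite szw leq_pmulr.
    by rewrite mem_iota k_gt1 (@leq_trans (size w).+1) // leq_addl.
  apply/hasP; exists (size u); last by rewrite tw -w_uk.
  by rewrite mem_iota /= add0n ltnS szw leq_pmull // ltnW.
apply/negP => /hasP[k]; rewrite mem_iota => /andP[k_gt1 _] /hasP[m _ /eqP w_mk].
by apply: npow; exists (take m w), k.
Qed.

Definition has_period p w : bool :=
  (0 < p) && all (fun i => onth w i == onth w (i + p)) (iota 0 (size w - p)).

Definition min_period p w : bool :=
  has_period p w && all (fun q => ~~ has_period q w) (iota 1 p.-1).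

(* x[i..j], with positions counted from 1; used for 1 <= i <= j <= size x. *)
Definition factor x i j : seq T := take (j.+1 - i) (drop i.-1 x).

Definition is_run_of_period x i j p : bool :=
  [&& 1 <= i, i <= j, j <= size x,
      min_period p (factor x i j),
      2 * p <= j - i + 1,
      ~~ ((1 <= i.-1) && has_period p (factor x i.-1 j)) &
      ~~ ((j.+1 <= size x) && has_period p (factor x i j.+1))].

(* The minimum period of a run is at most half its length, whence the bound. *)
Definition is_run x i j : bool :=
  has (is_run_of_period x i j) (iota 1 (size x)).

Definition TRL x : nat :=
  \sum_(1 <= i < (size x).+1) \sum_(1 <= j < (size x).+1 | is_run x i j)
    (j - i + 1).

End Words.

Local Open Scope ring_scope.

(* The value at 0 is irrelevant and set to 0. *)
Definition moebius (n : nat) : int :=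
  if (0 < n)%N && all (fun q => ~~ (q ^ 2 %| n)%N) (primes n)
  then (-1) ^+ size (primes n) else 0.

Definition nb_primitive (alpha p : nat) : rat :=
  \sum_(d <- divisors p) alpha%:R ^+ d * (moebius (p %/ d))%:~R.

Definition expected_TRL (A : finType) (n : nat) : rat :=
  (\sum_(w : n.-tuple A) (TRL w)%:R) / (#|A| ^ n)%:R.

(* Main.v *)
Require Import Defs.
From mathcomp Require Import all_boot all_order all_algebra.
From mathcomp Require Import zify ring.
Import Order.TTheory GRing.Theory Num.Theory.

Set Implicit Arguments.
Unset Strict Implicit.
Unset Printing Implicit Defensive.

(** By linearity, the expected total run length is a sum, over all periods [p]
    and all pairs of positions, of the length [k] of the factor there times the
    probability that this factor is a run of period [p]. Write the word as
    [u ++ v ++ z] with [v] the factor; the event splits into independent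
    conditions on [v], [u] and [z] ([is_run_of_period_cat]).

    A word [v] of length [k >= 2p] has minimum period [p] exactly when it has
    period [p] and its prefix of length [p] is primitive
    ([min_period_primitive]): a smaller period would combine with [p], by the
    periodicity theorem of Fine and Wilf, into a proper divisor of [p]. Such a
    [v] is determined by this prefix, so there are as many of them as primitive
    words of length [p] ([sum_has_period]). Maximality on a side means that the
    run touches the border of the word there, or that the adjacent letter is not
    the one that prolongs the period, which leaves all letters but one
    ([nb_avoiding]). Hence the probability is [P p * alpha ^- k] times a factor
    [1] for each side at the border and [(alpha - 1) / alpha] for each other
    side. Summing over the positions, the interior runs, the runs that touch
    exactly one border and the runs that fill the word give the three terms of
    the formula ([sum_side_weights]).

    The number of primitive words comes from Moebius inversion
    ([moebius_inversion]): each nonempty word has a unique primitive root, so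
    [alpha ^ p] is the sum over the divisors [d] of [p] of the number of
    primitive words of length [d] ([expn_primitive_roots]). *)

(** * Periods and primitivity *)

Section Periods.
Variables (T : eqType) (x0 : T).
Implicit Types (w u v z : seq T) (p q d : nat).

Lemma has_period_shiftP p w :
  reflect (0 < p /\ forall i, i + p < size w -> nth x0 w i = nth x0 w (i + p))
          (has_period p w).
Proof.
have onthS i : i < size w -> onth w i = Some (nth x0 w i).
  by move=> lt_iw; rewrite onthE (nth_map x0).
apply: (iffP andP) => -[p_gt0 per]; split=> //.
  move=> i lt_ipw; have := allP per i.
  rewrite mem_iota !onthS // ?(leq_ltn_trans _ lt_ipw) ?leq_addr //.
  by move=> per_i; have /eqP[] := per_i ltac:(lia).
apply/allP => i; rewrite mem_iota => lt_iwp.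
by rewrite !onthS 1?per //; lia.
Qed.

Lemma has_period_modP p w :
  reflect (0 < p /\ forall i, i < size w -> nth x0 w i = nth x0 w (i %% p))
          (has_period p w).
Proof.
apply: (iffP (has_period_shiftP p w)) => -[p_gt0 per]; split=> //.
  move=> i lt_iw; rewrite {1 2}(divn_eq i p) in lt_iw *.
  elim: (i %/ p) lt_iw => [|k IHk] lt_iw; first by rewrite mul0n.
  rewrite -IHk; last by lia.
  rewrite (per (k * p + i %% p)); last by lia.
  by congr nth; lia.
by move=> i lt_ipw; rewrite (per i) 1?(per (i + p)) ?modnDr //; lia.
Qed.

Lemma has_period_size w : 0 < size w -> has_period (size w) w.
Proof. by move=> w_gt0; apply/has_period_shiftP; split=> // i; lia. Qed.

Lemma has_period_take m p w : has_period p w -> has_period p (take m w).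
Proof.
case/has_period_shiftP=> p_gt0 per; apply/has_period_shiftP; split=> // i.
rewrite size_take_min => lt_ip; rewrite !nth_take 1?per //; lia.
Qed.

(** Reducing an index modulo [p] and then modulo a divisor [d] of [p] is the same
    as reducing it modulo [d]. *)
Lemma has_period_refine p d w :
  has_period p w -> p <= size w -> d %| p -> has_period d (take p w) ->
  has_period d w.
Proof.
case/has_period_modP=> p_gt0 per_p le_pw dv_dp /has_period_modP[d_gt0 per_d].
apply/has_period_modP; split=> // i lt_iw.
have lt_ip : i %% p < p by rewrite ltn_mod.
have := per_d (i %% p); rewrite size_take_min (minn_idPl le_pw) => /(_ lt_ip).
rewrite modn_dvdm // !nth_take // -?per_p //.
by rewrite (leq_trans _ (dvdn_leq p_gt0 dv_dp)) ?ltn_mod.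
Qed.

(** The weak form of the periodicity theorem of Fine and Wilf. Reading [w]
    cyclically modulo [p] gives a function on all of [nat] which is invariant
    under translation by [p] and by [q], hence by Bezout under translation by
    their gcd. *)
Lemma has_period_gcdn p q w :
  has_period p w -> has_period q w -> p + q <= size w ->
  has_period (gcdn p q) w.
Proof.
case/has_period_modP=> p_gt0 per_p /has_period_shiftP[q_gt0 per_q] le_pqw.
pose f i := nth x0 w (i %% p).
have fDp k i : f (i + k * p) = f i by rewrite /f addnC modnMDl.
have fDq i : f (i + q) = f i.
  have lt_ip : i %% p < p by rewrite ltn_mod.
  rewrite /f -modnDml -per_p; last by lia.
  by rewrite -per_q //; lia.
have fDkq k i : f (i + k * q) = f i.
  by elim: k => [|k IHk]; rewrite ?mul0n ?addn0 // mulSnr addnA fDq.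
have fDg i : f (i + gcdn p q) = f i.
  case: (egcdnP q p_gt0) => kp kq eq_g _.
  by rewrite -(fDkq kq (i + _)) -addnA [_ + kq * q]addnC -eq_g fDp.
apply/has_period_shiftP; split; first by rewrite gcdn_gt0 p_gt0.
move=> i lt_igw; rewrite per_p; last exact: leq_ltn_trans (leq_addr _ _) lt_igw.
by rewrite [RHS]per_p // -!/(f _) fDg.
Qed.

Lemma size_power k u : size (flatten (nseq k u)) = k * size u.
Proof. by elim: k => //= k IHk; rewrite size_cat IHk mulSn. Qed.

Lemma nth_power k u i :
  i < k * size u -> nth x0 (flatten (nseq k u)) i = nth x0 u (i %% size u).
Proof.
elim: k i => //= k IHk i lt_i; rewrite nth_cat.
case: ltnP => [lt_iu | le_ui]; first by rewrite modn_small.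
rewrite IHk; last by rewrite mulSn in lt_i; lia.
by rewrite -[in RHS](subnK le_ui) modnDr.
Qed.

(** For divisors [d] of the length, having period [d] is the same as being a
    power of the prefix of length [d]; primitivity thus becomes a statement
    about periods. *)
Lemma primitivePn u :
  0 < size u ->
  reflect (exists2 d, d < size u & (d %| size u) && has_period d u)
          (~~ primitive u).
Proof.
move=> u_gt0; apply: (iffP idP) => [nprim | [d lt_du /andP[dv_du per_d]]].
  move: nprim; rewrite /primitive negbK => /hasP[k].
  rewrite mem_iota => /andP[k_gt1 _].
  case/hasP=> m _ /eqP; set t := take m u => u_kt.
  have szu : size u = k * size t by rewrite {1}u_kt size_power.
  have t_gt0 : 0 < size t by move: u_gt0; rewrite szu muln_gt0 => /andP[].
  exists (size t); first by rewrite szu -{1}[size t]mul1n ltn_pmul2r.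
  rewrite {1}szu dvdn_mull //=; apply/has_period_modP; split=> // i lt_iu.
  have lt_it : i %% size t < size t by rewrite ltn_mod.
  rewrite {1}u_kt nth_power -?szu // u_kt nth_power ?modn_mod //.
  by rewrite (leq_trans lt_it) // leq_pmull //; lia.
apply/negP => /primitiveP; apply; exists (take d u), (size u %/ d).
case/has_period_modP: per_d => d_gt0 per_d.
have szt : size (take d u) = d by rewrite size_takel // ltnW.
split; first by rewrite ltn_divRL // mul1n.
apply: (@eq_from_nth _ x0); first by rewrite size_power szt divnK.
move=> i lt_iu; rewrite nth_power szt ?divnK // per_d //.
by rewrite nth_take // ltn_mod.
Qed.

(** Two periods that fit together in [w] have a common divisor as a period, and
    if [p] is the larger one, this divisor exhibits the prefix of length [p] as
    a proper power. *)
Lemma has_period_root_primitive p q w :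
  has_period p w -> has_period q w -> p + q <= size w -> primitive (take p w) ->
  p <= q.
Proof.
move=> per_p per_q le_pqw prim; rewrite leqNgt; apply/negP => lt_qp.
have p_gt0 : 0 < p by case/has_period_modP: per_p.
have q_gt0 : 0 < q by case/has_period_modP: per_q.
have szp : size (take p w) = p by rewrite size_takel; lia.
suff: ~~ primitive (take p w) by rewrite prim.
apply/primitivePn; rewrite szp //; exists (gcdn p q).
  exact: leq_ltn_trans (dvdn_leq q_gt0 (dvdn_gcdr _ _)) lt_qp.
by rewrite dvdn_gcdl has_period_take // has_period_gcdn.
Qed.

(** The bound on the length makes [p] and any smaller period [q] fit together in
    [w], as [has_period_root_primitive] requires. *)
Lemma min_period_primitive p w :
  2 * p <= size w -> min_period p w = has_period p w && primitive (take p w).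
Proof.
move=> le_2pw; rewrite /min_period.
have [per_p /=|//] := boolP (has_period p w).
have p_gt0 : 0 < p by case/has_period_modP: per_p.
have szp : size (take p w) = p by rewrite size_takel; lia.
apply/allP/idP => [min_p | prim q].
  have [//|/primitivePn] := boolP (primitive (take p w)); rewrite szp.
  case=> // d lt_dp /andP[dv_dp per_d].
  have per_dw : has_period d w by apply: has_period_refine per_d => //; lia.
  have d_gt0 : 0 < d by case/has_period_modP: per_dw.
  have /min_p : d \in iota 1 p.-1 by rewrite mem_iota; lia.
  by rewrite per_dw.
rewrite mem_iota => lt_qp; apply/negP => per_q.
have := has_period_root_primitive per_p per_q; rewrite prim; lia.
Qed.

(** The length of the primitive root is the least period dividing the length of
    the word. It is the only candidate: a larger one [e], if it is not the whole
    length, is at most half of it, so [e] and the least one fit together and the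
    prefix of length [e] is not primitive. *)
Lemma count_primitive_root w :
  0 < size w ->
  count (fun d => has_period d w && primitive (take d w)) (divisors (size w))
    = 1.
Proof.
move=> w_gt0.
have ex_d : exists d, (d %| size w) && has_period d w.
  by exists (size w); rewrite dvdnn has_period_size.
case: (ex_minnP ex_d) => d /andP[dv_d per_d] min_d.
have d_gt0 : 0 < d by case/has_period_modP: per_d.
have le_dw := dvdn_leq w_gt0 dv_d.
have szd : size (take d w) = d by rewrite size_takel.
transitivity (count (pred1 d) (divisors (size w))); last first.
  by rewrite count_uniq_mem ?divisors_uniq // -dvdn_divisors // dv_d.
apply: eq_in_count => e; rewrite -dvdn_divisors // => dv_e /=.
apply/andP/eqP => [[per_e prim_e] | ->]; last first.
  split=> //; have [//|/primitivePn] := boolP (primitive (take d w)).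
  rewrite szd; case=> // c lt_cd /andP[dv_cd per_c].
  have := min_d c; rewrite (dvdn_trans dv_cd) //=.
  by rewrite (has_period_refine per_d le_dw dv_cd per_c) => /(_ isT); lia.
have le_de : d <= e by apply: min_d; rewrite dv_e.
apply/eqP; rewrite eqn_leq le_de andbT leqNgt; apply/negP => lt_de.
have le_ew := dvdn_leq w_gt0 dv_e.
have [eq_ew | ne_ew] := eqVneq e (size w).
  suff: ~~ primitive w by rewrite -{1}(take_size w) -eq_ew prim_e.
  by apply/primitivePn => //; exists d; [lia | rewrite dv_d].
have le_2ew : 2 * e <= size w.
  by case/dvdnP: dv_e => -[|[|k]] eq_w; lia.
have := has_period_root_primitive per_e per_d; rewrite prim_e; lia.
Qed.

Lemma has_period_cat p u z :
  size u = p -> 0 < p ->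
  has_period p (u ++ z) = (z == mkseq (fun i => nth x0 u (i %% p)) (size z)).
Proof.
move=> szu p_gt0; apply/has_period_modP/eqP => [[_ per] | z_eq].
  apply: (@eq_from_nth _ x0); rewrite ?size_mkseq // => i lt_iz.
  have := per (p + i); rewrite size_cat szu nth_mkseq // ltn_add2l => /(_ lt_iz).
  rewrite !nth_cat szu modnDl ltn_mod p_gt0 => <-.
  by rewrite ltnNge leq_addr addKn.
split=> // i; rewrite size_cat szu !nth_cat szu ltn_mod p_gt0 => lt_i.
case: ltnP => [/modn_small-> // | le_pi].
rewrite z_eq nth_mkseq; last by lia.
by rewrite -{2}(subnK le_pi) modnDr.
Qed.

Lemma has_period_cons p c v :
  0 < p <= size v ->
  has_period p (c :: v) = has_period p v && (c == nth x0 v p.-1).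
Proof.
move=> /andP[p_gt0 le_pv].
apply/has_period_shiftP/andP => [[_ per] | [/has_period_shiftP[_ per] /eqP c_eq]].
  split.
    by apply/has_period_shiftP; split=> // i lt_i; apply: (per i.+1); rewrite /=; lia.
  by have := per 0; case: (p) p_gt0 le_pv => //= q _ lt_qv ->.
split=> // -[|i] /= lt_i; last exact: per.
by rewrite c_eq; case: (p) p_gt0.
Qed.

Lemma has_period_rcons p c v :
  0 < p <= size v ->
  has_period p (rcons v c) = has_period p v && (c == nth x0 v (size v - p)).
Proof.
move=> /andP[p_gt0 le_pv].
apply/has_period_shiftP/andP => [[_ per] | [/has_period_shiftP[_ per] /eqP c_eq]].
  split.
    apply/has_period_shiftP; split=> // i lt_i.
    have lt_iv : i < size v by lia.
    by have := per i; rewrite size_rcons !nth_rcons lt_i lt_iv; apply; lia.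
  have := per (size v - p); rewrite size_rcons subnK // !nth_rcons ltnn eqxx.
  by rewrite ltn_subrL p_gt0 (leq_trans p_gt0) //= => /(_ (ltnSn _)) ->.
split=> // i; rewrite size_rcons ltnS => le_i; rewrite !nth_rcons.
have -> : i < size v by lia.
case: ltnP => [|ge_i]; first exact: per.
have -> : i + p = size v by lia.
by rewrite eqxx c_eq; congr nth; lia.
Qed.

(** Once [v] has period [p], extending it by one letter preserves the period only
    for one value of this letter, which [v] determines. The conditions on [u] and
    [z] therefore involve only their letters next to [v]. *)
Lemma is_run_of_period_cat p u v z :
  is_run_of_period (u ++ v ++ z) (size u).+1 (size u + size v) p =
    [&& 2 * p <= size v, has_period p v && primitive (take p v),
        (size u == 0) || (last x0 u != nth x0 v p.-1) &
        (size z == 0) || (head x0 z != nth x0 v (size v - p))].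
Proof.
rewrite /is_run_of_period /factor /=.
have -> : (size u + size v).+1 - (size u).+1 = size v by lia.
rewrite drop_size_cat // take_size_cat //.
have [p0 | p_gt0] := posnP p.
  by rewrite p0 /min_period /has_period /= !andbF.
have [le_2pv | lt_v2p] := leqP (2 * p) (size v); last first.
  by rewrite (_ : 2 * p <= _ = false) ?andbF //; lia.
rewrite min_period_primitive //.
have -> : size u < size u + size v by lia.
have -> : size u + size v <= size (u ++ v ++ z) by rewrite !size_cat; lia.
have -> : 2 * p <= size u + size v - (size u).+1 + 1 by lia.
have [per /=|//] := boolP (has_period p v).
case: (primitive _) => //=; congr (_ && _).
  case/lastP: u => [|u c]; first by [].
  rewrite size_rcons last_rcons /= -cats1 -catA drop_size_cat //=.
  rewrite [X in take X _](_ : _ = (size v).+1); last by lia.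
  by rewrite /= take_size_cat // has_period_cons ?per //; lia.
case: z => [|c z]; first by rewrite cats0 size_cat ltnn.
rewrite !size_cat /= ltn_add2l addnS ltnS leq_addr /=.
rewrite [X in take X _](_ : _ = (size v).+1); last by lia.
rewrite -cat_rcons take_size_cat ?size_rcons //.
by rewrite has_period_rcons ?per //; lia.
Qed.

End Periods.

(** * Counting words *)

Section Counting.
Variables (A : finType) (x0 : A).
Implicit Types (F : seq A -> nat) (Q : pred (seq A)).

Lemma card_words n Q : #|[set w : n.-tuple A | Q w]| = \sum_(w : n.-tuple A) Q w.
Proof. by rewrite -sum1dep_card big_mkcond; apply: eq_bigr => w _; case: (Q w). Qed.

Lemma sum_tuple_cat m n F :
  \sum_(w : (m + n).-tuple A) F w =
  \sum_(u : m.-tuple A) \sum_(v : n.-tuple A) F (u ++ v).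
Proof.
rewrite pair_big /=.
pose cat_pair (uv : m.-tuple A * n.-tuple A) := cat_tuple uv.1 uv.2.
have inj_cat : injective cat_pair.
  move=> [u v] [u' v'] /(congr1 val) /= /eqP.
  by rewrite eqseq_cat ?size_tuple // => /andP[/eqP/val_inj-> /eqP/val_inj->].
rewrite (reindex cat_pair) //; apply: onW_bij; apply: inj_card_bij inj_cat _.
by rewrite card_prod !card_tuple expnD.
Qed.

Lemma sum_word1_neq c : \sum_(v : 1.-tuple A) (head x0 v != c) = #|A|.-1.
Proof.
have inj1 : injective (fun a : A => [tuple a]) by move=> a b /(congr1 val) [].
rewrite (reindex (fun a : A => [tuple a])) /=; last first.
  by apply: onW_bij; apply: inj_card_bij inj1 _; rewrite card_tuple expn1.
rewrite -(cardC1 c) -sum1_card [RHS]big_mkcond; apply: eq_bigr => a _.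
by rewrite !inE; case: eqP.
Qed.

(** The number of words of length [m] over [q] letters whose letter at a given
    end differs from a prescribed one; the empty word has no such letter and
    counts as admissible, like a run that touches the border of the word. *)
Definition nb_avoiding q m := if m is m'.+1 then q.-1 * q ^ m' else 1.

Lemma sum_tuple0 F : \sum_(u : 0.-tuple A) F u = F [::].
Proof.
rewrite (eq_bigr (fun => F [::])); last by move=> u _; rewrite tuple0.
by rewrite sum_nat_const card_tuple expn0 mul1n.
Qed.

Lemma sum_last_neq m c :
  \sum_(u : m.-tuple A) ((m == 0) || (last x0 u != c)) = nb_avoiding #|A| m.
Proof.
case: m => [|m] /=; first exact: (sum_tuple0 xpredT).
rewrite -addn1 (sum_tuple_cat m 1 (fun w => last x0 w != c)).
under eq_bigr => u _.
  rewrite (eq_bigr (fun v : 1.-tuple A => nat_of_bool (head x0 v != c))).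
    rewrite sum_word1_neq; over.
  by move=> v _; case/tupleP: v => a v; rewrite tuple0 /= last_cat.
by rewrite sum_nat_const card_tuple mulnC.
Qed.

Lemma sum_head_neq m c :
  \sum_(u : m.-tuple A) ((m == 0) || (head x0 u != c)) = nb_avoiding #|A| m.
Proof.
case: m => [|m] /=; first exact: (sum_tuple0 xpredT).
rewrite -add1n (sum_tuple_cat 1 m (fun w => head x0 w != c)).
under eq_bigr => u _.
  rewrite (eq_bigr (fun v : m.-tuple A => nat_of_bool (head x0 u != c))).
    rewrite sum_nat_const card_tuple; over.
  by move=> v _; case/tupleP: u => a u.
by rewrite -big_distrr /= sum_word1_neq mulnC.
Qed.

(** A word with period [p] is the periodic extension of its prefix of length
    [p], so summing over such words amounts to summing over their prefixes. *)
Lemma sum_has_period p k Q :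
  0 < p <= k ->
  \sum_(w : k.-tuple A) (has_period p w && Q (take p w)) =
  #|[set u : p.-tuple A | Q u]|.
Proof.
move=> /andP[p_gt0 le_pk]; rewrite card_words.
rewrite -(subnKC le_pk) (sum_tuple_cat _ _ (fun w => has_period p w && Q (take p w))).
apply: eq_bigr => u _; pose s := mkseq (fun i => nth x0 u (i %% p)) (k - p).
have szs : size s == k - p by rewrite size_mkseq.
rewrite (bigD1 (Tuple szs)) //= big1 => [|z ne_z].
  by rewrite (has_period_cat x0) ?size_tuple // eqxx take_size_cat ?size_tuple ?addn0.
rewrite (has_period_cat x0) ?size_tuple // take_size_cat ?size_tuple //.
by move: ne_z; rewrite -val_eqE /= -/s => /negPf->.
Qed.

Lemma sum_run_of_period p a k b :
  0 < p ->
  \sum_(w : (a + (k + b)).-tuple A) is_run_of_period w a.+1 (a + k) p =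
  (2 * p <= k) * #|[set u : p.-tuple A | primitive u]| *
    (nb_avoiding #|A| a * nb_avoiding #|A| b).
Proof.
move=> p_gt0.
rewrite (sum_tuple_cat _ _ (fun w => is_run_of_period w a.+1 (a + k) p)).
under eq_bigr => u _.
  rewrite (sum_tuple_cat _ _ (fun w => is_run_of_period (u ++ w) a.+1 (a + k) p)).
  under eq_bigr => v _.
    rewrite (eq_bigr (fun z : b.-tuple A =>
      (2 * p <= k) * (has_period p v && primitive (take p v)) *
      ((a == 0) || (last x0 u != nth x0 v p.-1)) *
      ((b == 0) || (head x0 z != nth x0 v (k - p))))); last first.
      move=> z _; have := is_run_of_period_cat x0 p u v z.
      by rewrite !size_tuple => ->; rewrite -!mulnb !mulnA.
    rewrite -big_distrr /= sum_head_neq; over.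
  over.
rewrite exchange_big /=.
under eq_bigr => v _.
  rewrite -big_distrl -big_distrr /= sum_last_neq -mulnA.
  over.
rewrite -big_distrl /= -big_distrr /=.
have [le_2pk|//] := leqP (2 * p) k.
by rewrite sum_has_period //; lia.
Qed.

(** Sorts the words of length [p] by the length [d] of their primitive root; the
    words with a root of length [d] are counted by their prefixes. *)
Lemma expn_primitive_roots p :
  0 < p ->
  #|A| ^ p = \sum_(d <- divisors p) #|[set u : d.-tuple A | primitive u]|.
Proof.
move=> p_gt0.
transitivity (\sum_(w : p.-tuple A) \sum_(d <- divisors p)
                 (has_period d w && primitive (take d w))).
  rewrite -card_tuple -sum1_card; apply: eq_bigr => w _.
  have := @count_primitive_root _ x0 w; rewrite size_tuple => <- //.
  by rewrite -sum1_count big_mkcond; apply: eq_bigr => d _; case: (_ && _).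
rewrite exchange_big; apply: eq_big_seq => d.
rewrite -dvdn_divisors // => dv_dp; apply: sum_has_period.
by rewrite (dvdn_gt0 p_gt0 dv_dp) dvdn_leq.
Qed.

End Counting.

(** * Moebius inversion *)

Lemma moebius_primeM q d :
  prime q -> 0 < d -> ~~ (q %| d) -> moebius (q * d) = (- moebius d)%R.
Proof.
move=> q_pr d_gt0 ndv_qd; have q_gt0 := prime_gt0 q_pr.
have primes_qd : perm_eq (primes (q * d)) (q :: primes d).
  apply: uniq_perm; first exact: primes_uniq.
    by rewrite /= primes_uniq mem_primes (negPf ndv_qd) !andbF.
  by move=> r; rewrite primesM // primes_prime // !inE.
rewrite /moebius muln_gt0 q_gt0 d_gt0 (perm_all _ primes_qd) (perm_size primes_qd).
rewrite /= expnS expn1 dvdn_pmul2l // ndv_qd /=.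
have -> : all (fun r => ~~ (r ^ 2 %| q * d)) (primes d)
        = all (fun r => ~~ (r ^ 2 %| d)) (primes d).
  apply: eq_in_all => r; rewrite mem_primes => /and3P[r_pr _ dv_rd].
  rewrite Gauss_dvdr // coprimeXl // prime_coprime // dvdn_prime2 //.
  by apply: contraNneq ndv_qd => <-.
by case: ifP => _; rewrite ?exprS ?mulN1r ?oppr0.
Qed.

Lemma moebius_sq q d : prime q -> q ^ 2 %| d -> moebius d = 0%R.
Proof.
move=> q_pr dv_q2d; rewrite /moebius; case: posnP => //= d_gt0.
case: allP => // sqfree; have : q \in primes d.
  by rewrite mem_primes q_pr d_gt0 (dvdn_trans _ dv_q2d) // expnS dvdn_mulr.
by move/sqfree; rewrite dv_q2d.
Qed.

(** With [q] a prime divisor of [n], the divisors [d] of [n] that [q] does not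
    divide cancel against the divisors [q * d], and [moebius] vanishes at all
    others. *)
Lemma sum_moebius n :
  0 < n -> (\sum_(d <- divisors n) moebius d = (n == 1%N)%:R)%R.
Proof.
move=> n_gt0; have [->|n_neq1] := eqVneq n 1%N.
  by rewrite (_ : divisors 1 = [:: 1%N]) // big_seq1.
have q_pr : prime (pdiv n) by apply: pdiv_prime; lia.
have dv_qn := pdiv_dvd n; set q := pdiv n in q_pr dv_qn.
have q_gt0 := prime_gt0 q_pr.
rewrite (bigID (fun d => q %| d)%N) /=.
rewrite (bigID (fun d => q ^ 2 %| d)%N) /=.
rewrite big1 => [|d /andP[_ /(moebius_sq q_pr)] //]; rewrite add0r.
rewrite -big_filter.
have perm_div : perm_eq [seq d <- divisors n | (q %| d) && ~~ (q ^ 2 %| d)]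
                        [seq q * d | d <- divisors n & ~~ (q %| d)].
  apply: uniq_perm; first by rewrite filter_uniq ?divisors_uniq.
    rewrite map_inj_uniq ?filter_uniq ?divisors_uniq // => d e /eqP.
    by rewrite eqn_pmul2l // => /eqP.
  move=> d; rewrite mem_filter -dvdn_divisors //.
  apply/andP/mapP => [[/andP[/dvdnP[e ->] ndv] dv] | [e]].
    rewrite mulnC expnS expn1 dvdn_pmul2l // in ndv *.
    exists e => //; rewrite mem_filter ndv -dvdn_divisors //.
    exact: dvdn_trans (dvdn_mulr _ _) dv.
  rewrite mem_filter -dvdn_divisors // => /andP[ndv dv] ->.
  rewrite dvdn_mulr //= expnS expn1 dvdn_pmul2l // ndv.
  by rewrite Gauss_dvd ?prime_coprime // dv_qn.
rewrite (perm_big _ perm_div) big_map big_filter -big_split big_seq_cond.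
rewrite big1 // => d; rewrite -dvdn_divisors // => /andP[dv_dn ndv_qd].
by rewrite moebius_primeM ?(dvdn_gt0 n_gt0) //= addNr.
Qed.

(** After substituting the sums for [f] and exchanging, the coefficient of [g e]
    is a sum of [moebius] over the divisors of [n %/ e]. *)
Lemma moebius_inversion (R : comNzRingType) (f g : nat -> R) :
  (forall n, (0 < n)%N -> f n = \sum_(d <- divisors n) g d)%R ->
  forall n, 0 < n ->
    (\sum_(d <- divisors n) f d * (moebius (n %/ d))%:~R = g n)%R.
Proof.
move=> fE n n_gt0.
transitivity (\sum_(d <- divisors n) \sum_(e <- divisors n | (e %| d)%N)
                 g e * (moebius (n %/ d))%:~R)%R.
  apply: eq_big_seq => d; rewrite -dvdn_divisors // => dv_dn.
  have d_gt0 := dvdn_gt0 n_gt0 dv_dn.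
  rewrite fE // mulr_suml -[RHS]big_filter; apply: perm_big; apply: uniq_perm.
  - exact: divisors_uniq.
  - by rewrite filter_uniq ?divisors_uniq.
  move=> e; rewrite mem_filter -!dvdn_divisors //.
  by case dv_ed: (e %| d); rewrite // (dvdn_trans dv_ed).
rewrite (exchange_big_dep xpredT) //=.
transitivity (\sum_(e <- divisors n) g e * (n == e)%:R)%R.
  apply: eq_big_seq => e; rewrite -dvdn_divisors // => dv_en.
  have e_gt0 := dvdn_gt0 n_gt0 dv_en.
  have [m n_eq] := dvdnP dv_en; have m_gt0 : 0 < m by lia.
  rewrite -mulr_sumr -big_filter; congr (_ * _)%R.
  (* The multiples of [e] among the divisors of [n] are the codivisors of the
     divisors of [m = n %/ e]. *)
  have perm_div : perm_eq [seq d <- divisors n | e %| d]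
                          [seq n %/ d | d <- divisors m].
    apply: uniq_perm; first by rewrite filter_uniq ?divisors_uniq.
      rewrite map_inj_in_uniq ?divisors_uniq // => c d.
      rewrite -!dvdn_divisors // => dv_c dv_d eq_cd.
      have {}dv_c : c %| n by rewrite n_eq dvdn_mulr.
      have {}dv_d : d %| n by rewrite n_eq dvdn_mulr.
      apply/eqP; rewrite -(eqn_pmul2l (_ : 0 < n %/ c)).
        by rewrite {2}eq_cd !divnK.
      have c_gt0 := dvdn_gt0 n_gt0 dv_c.
      by rewrite divn_gt0 ?(dvdn_leq n_gt0 dv_c).
    move=> d; rewrite mem_filter -dvdn_divisors //.
    apply/andP/mapP => [[/dvdnP[c ->]] | [c]].
      rewrite n_eq dvdn_pmul2r // => dv_cm; exists (m %/ c).
        by rewrite -dvdn_divisors // dvdn_div.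
      have c_gt0 := dvdn_gt0 m_gt0 dv_cm.
      have /dvdnP[b m_eq] := dv_cm; have b_gt0 : 0 < b by lia.
      by rewrite m_eq mulnK // -mulnA mulKn.
    rewrite -dvdn_divisors // => /dvdnP[b m_eq] ->.
    have c_gt0 : 0 < c by lia.
    rewrite n_eq m_eq -mulnA mulnCA mulKn // dvdn_mull //; split=> //.
    by rewrite dvdn_mull.
  rewrite (perm_big _ perm_div) big_map.
  under eq_big_seq => d.
    rewrite -dvdn_divisors // => dv_dm.
    rewrite divnA; last by rewrite n_eq dvdn_mulr.
    rewrite mulKn //; over.
  rewrite -rmorph_sum sum_moebius //=.
  by rewrite n_eq -{2}[e]mul1n eqn_pmul2r //; case: eqP.
rewrite (bigD1_seq n) ?divisors_uniq -?dvdn_divisors //= eqxx mulr1.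
by rewrite big1 ?addr0 // => d; rewrite eq_sym => /negPf->; rewrite mulr0.
Qed.

Lemma nb_primitive_card (A : finType) (x0 : A) p :
  0 < p ->
  nb_primitive #|A| p = (#|[set u : p.-tuple A | primitive u]|%:R)%R.
Proof.
move: p; apply: (@moebius_inversion _ (fun d => #|A|%:R ^+ d)%R) => p p_gt0.
by rewrite -natrX (expn_primitive_roots x0 p_gt0) natr_sum.
Qed.

(** * Summing over the runs *)

Lemma min_period_uniq (T : eqType) (w : seq T) p q :
  min_period p w -> min_period q w -> p = q.
Proof.
have le_pq r s : min_period r w -> min_period s w -> r <= s.
  move=> /andP[_ /allP min_r] /andP[per_s _]; rewrite leqNgt; apply/negP => lt_sr.
  have s_gt0 : 0 < s by case/andP: per_s.
  have /min_r : s \in iota 1 r.-1 by rewrite mem_iota; lia.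
  by rewrite per_s.
by move=> min_p min_q; apply/eqP; rewrite eqn_leq !le_pq.
Qed.

(** A run has only one minimum period, so summing over all periods counts it
    once. *)
Lemma is_run_sum (T : eqType) (x : seq T) i j :
  is_run x i j = \sum_(1 <= p < (size x).+1) is_run_of_period x i j p :> nat.
Proof.
rewrite /is_run; have [/hasP[p p_in run_p] | /hasPn no_run] := boolP (has _ _).
  have per_p : min_period p (factor x i j) by case/and4P: run_p => _ _ _ /andP[].
  rewrite /index_iota subSS subn0 (bigD1_seq p) ?iota_uniq //= run_p big1 //.
  move=> q ne_qp; apply/eqP; rewrite eqb0; apply: contraNN ne_qp => run_q.
  have per_q : min_period q (factor x i j) by case/and4P: run_q => _ _ _ /andP[].
  by rewrite (min_period_uniq per_q per_p).
rewrite /index_iota subSS subn0 big_seq_cond big1 // => p; rewrite andbT => p_in.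
by rewrite (negPf (no_run _ p_in)).
Qed.

(** A run from [i] to [j] is located here by the number [a = i - 1] of letters
    before it and by its length [k = j - i + 1], which cut the word into three
    blocks of known lengths. *)
Lemma TRL_by_length (T : eqType) (x : seq T) :
  TRL x = \sum_(1 <= p < (size x).+1) \sum_(0 <= a < size x)
            \sum_(1 <= k < (size x - a).+1)
              is_run_of_period x a.+1 (a + k) p * k.
Proof.
rewrite /TRL big_add1 /= exchange_big /=; apply: eq_big_nat => a /andP[_ lt_an].
rewrite exchange_big /= (@big_cat_nat _ _ _ a.+1) //=; last by lia.
rewrite big_nat_cond big1 ?add0n => [|j /andP[/andP[_ lt_ja]]]; last first.
  case/hasP=> p _; case/and3P=> _; lia.
rewrite -add1n big_addn subSn; last by lia.
rewrite big_mkcond; apply: eq_big_nat => k /andP[k_gt0 _]; rewrite ?add1n (addnC k).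
rewrite -big_distrl /= -is_run_sum.
by case: (is_run _ _ _) => /=; lia.
Qed.

Lemma sum_run_counts (A : finType) (x0 : A) n :
  \sum_(w : n.-tuple A) TRL w =
  \sum_(1 <= p < n.+1) #|[set u : p.-tuple A | primitive u]| *
    \sum_(0 <= a < n) nb_avoiding #|A| a *
      \sum_(1 <= k < (n - a).+1)
        (2 * p <= k) * k * nb_avoiding #|A| (n - a - k).
Proof.
under [LHS]eq_bigr => w _ do rewrite TRL_by_length size_tuple.
rewrite exchange_big; apply: eq_big_nat => p /andP[p_gt0 _].
rewrite exchange_big big_distrr; apply: eq_big_nat => a /andP[_ lt_an].
rewrite exchange_big !big_distrr; apply: eq_big_nat => k /andP[_ le_k].
rewrite -big_distrl /=.
have n_eq : n = a + (k + (n - a - k)) by lia.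
rewrite [X in X * k](_ : _ = (2 * p <= k) *
    #|[set u : p.-tuple A | primitive u]| *
    (nb_avoiding #|A| a * nb_avoiding #|A| (n - a - k))); first by ring.
rewrite -(sum_run_of_period x0) //; move: n_eq.
by move: (n - a - k) => b ->.
Qed.

Local Open Scope ring_scope.

(** The factor contributed by one side of a run: the run either reaches the
    border of the word or is stopped by a letter that breaks the period. *)
Definition side_weight (R : pzSemiRingType) (c : R) (m : nat) : R :=
  if m == 0%N then 1 else c.

Lemma nb_avoiding_weight (R : fieldType) q m : q%:R != 0 :> R ->
  (nb_avoiding q m)%:R = side_weight ((q%:R - 1) / q%:R) m * q%:R ^+ m :> R.
Proof.
move=> q_neq0; case: m => [|m]; first by rewrite mulr1.
have q_gt0 : (0 < q)%N by case: (q) q_neq0; rewrite ?eqxx.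
rewrite /= natrM natrX -subn1 natrB // exprS.
by rewrite /side_weight /=; field.
Qed.

(** The four cases according to whether a run reaches the left or the right
    border; the two mixed cases are mirror images. *)
Lemma sum_side_weights (R : comNzRingType) (c : R) (h : nat -> R) n :
  (0 < n)%N ->
  \sum_(0 <= a < n) side_weight c a *
     \sum_(1 <= k < (n - a).+1) h k * side_weight c (n - a - k) =
  c ^+ 2 * (\sum_(1 <= i < n) \sum_(1 <= k < n - i) h k)
  + 2 * c * (\sum_(1 <= k < n) h k) + h n.
Proof.
move=> n_gt0.
have inner m : (0 < m)%N ->
    \sum_(1 <= k < m.+1) h k * side_weight c (m - k) =
    c * (\sum_(1 <= k < m) h k) + h m.
  move=> m_gt0; rewrite big_nat_recr //= subnn mulr1; congr (_ + _).
  rewrite mulr_sumr; apply: eq_big_nat => k /andP[_ lt_km].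
  by rewrite mulrC /side_weight subn_eq0 leqNgt lt_km.
rewrite big_ltn // mul1r subn0 inner //.
have -> : \sum_(1 <= a < n) side_weight c a *
     \sum_(1 <= k < (n - a).+1) h k * side_weight c (n - a - k) =
   \sum_(1 <= a < n) (c ^+ 2 * (\sum_(1 <= k < n - a) h k) + c * h (n - a)%N).
  apply: eq_big_nat => -[//|a] /andP[_ lt_an].
  by rewrite inner ?subn_gt0 // mulrDr mulrA -expr2.
rewrite big_split /= -!mulr_sumr.
have -> : \sum_(1 <= a < n) h (n - a)%N = \sum_(1 <= k < n) h k.
  by rewrite [RHS]big_nat_rev; apply: eq_big_nat => k _; rewrite add1n subSS.
ring.
Qed.

Lemma big_nat_vanish_tail (V : nmodType) (F : nat -> V) a m n :
  (a <= m <= n)%N -> (forall i, (m <= i < n)%N -> F i = 0) ->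
  \sum_(a <= i < n) F i = \sum_(a <= i < m) F i.
Proof.
move=> /andP[le_am le_mn] F0; rewrite (big_cat_nat le_am le_mn) /=.
by rewrite [X in _ + X]big_nat_cond [X in _ + X]big1 ?addr0 // => i /andP[/F0].
Qed.

Lemma big_nat_threshold (V : nmodType) (g : nat -> V) m s :
  (0 < s)%N ->
  \sum_(1 <= k < m) (if (s <= k)%N then g k else 0) = \sum_(s <= k < m) g k.
Proof. by move=> s_gt0; rewrite [RHS](big_nat_widenl _ 1%N) // big_mkcond. Qed.

Theorem theorem9 (n alpha : nat) (A : finType)
    (hn : (1 <= n)%N) (halpha : (1 <= alpha)%N) (hA : #|A| = alpha) :
  let P := nb_primitive alpha in
  (forall p : nat, (1 <= p)%N ->
     P p = #|[set w : p.-tuple A | primitive w]|%:R) /\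
  expected_TRL A n =
    (alpha%:R - 1) ^+ 2 / alpha%:R ^+ 2 *
      (\sum_(1 <= p < ((n - 2) %/ 2).+1) P p *
         \sum_(1 <= i < (n - 2 * p - 1).+1)
           \sum_(2 * p <= k < (n - i - 1).+1) k%:R * alpha%:R ^- k)
    + 2 * ((alpha%:R - 1) / alpha%:R) *
      (\sum_(1 <= p < ((n - 1) %/ 2).+1) P p *
         \sum_(2 * p <= k < (n - 1).+1) k%:R * alpha%:R ^- k)
    + n%:R / alpha%:R ^+ n * (\sum_(1 <= p < (n %/ 2).+1) P p).
Proof.
move=> P.
have [x0 _] : exists x0 : A, x0 \in A by apply/card_gt0P; rewrite hA.
have PE p : (1 <= p)%N -> P p = #|[set w : p.-tuple A | primitive w]|%:R.
  by rewrite /P -hA; apply: nb_primitive_card.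
split=> //.
have q_neq0 : alpha%:R != 0 :> rat by rewrite pnatr_eq0 -lt0n.
set c : rat := (alpha%:R - 1) / alpha%:R.
pose g k : rat := k%:R * alpha%:R ^- k.
pose h p k : rat := if (2 * p <= k)%N then g k else 0.
have -> : expected_TRL A n = \sum_(1 <= p < n.+1) P p *
    (c ^+ 2 * (\sum_(1 <= i < n) \sum_(1 <= k < n - i) h p k)
     + 2 * c * (\sum_(1 <= k < n) h p k) + h p n).
  rewrite /expected_TRL -natr_sum (sum_run_counts x0) hA natr_sum mulr_suml.
  apply: eq_big_nat => p /andP[p_gt0 _]; rewrite natrM -PE // -mulrA.
  congr (_ * _); rewrite -sum_side_weights // natr_sum mulr_suml.
  apply: eq_big_nat => a /andP[_ lt_an].
  rewrite natrM natr_sum (nb_avoiding_weight _ q_neq0) -/c -!mulrA.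
  congr (_ * _); rewrite mulr_suml mulr_sumr.
  apply: eq_big_nat => k /andP[_ le_k].
  rewrite !natrM (nb_avoiding_weight _ q_neq0) -/c /h /g natrX.
  have -> : (alpha%:R ^+ n)^-1 =
      alpha%:R ^- a * alpha%:R ^- k * alpha%:R ^- (n - a - k) :> rat.
    rewrite -!invfM -!exprD; congr (_ ^- _); lia.
  case: (leqP _ k) => _; last by rewrite !mul0r mulr0.
  by rewrite mul1r; field; rewrite !expf_neq0.
have sum_h p m : (1 <= p)%N ->
    \sum_(1 <= k < m) h p k = \sum_(2 * p <= k < m) g k.
  by move=> p_gt0; rewrite big_nat_threshold // muln_gt0.
under eq_big_nat => p /andP[p_gt0 _].
  rewrite (_ : P p * _ =
      c ^+ 2 * (P p * \sum_(1 <= i < (n - 2 * p - 1).+1)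
                  \sum_(2 * p <= k < (n - i - 1).+1) g k)
    + 2 * c * (P p * \sum_(2 * p <= k < (n - 1).+1) g k) + P p * h p n);
    last first.
    (* Fewer than [2 * p] letters remain for a run preceded by more than
       [n - 2 * p - 1] letters and followed by at least one. *)
    rewrite (@big_nat_vanish_tail _ _ _ (n - 2 * p - 1).+1).
    - rewrite sum_h // (_ : (n - 1).+1 = n); last by lia.
      under [in LHS]eq_big_nat => i lt_i do rewrite sum_h //.
      rewrite [X in c ^+ 2 * X](_ : _ = \sum_(1 <= i < (n - 2 * p - 1).+1)
                  \sum_(2 * p <= k < (n - i - 1).+1) g k); first by ring.
      by apply: eq_big_nat => i lt_i; congr (\sum_(_ <= k < _) g k); lia.
    - lia.
    - by move=> i lt_i; rewrite sum_h // big_geq //; lia.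
  over.
(* Each of the three sums stops at the largest period for which a run of length
   at least [2 * p] can leave two, one or no letters outside. *)
rewrite !big_split /= -!mulr_sumr expr_div_n; congr (_ * _ + _ * _ + _).
- apply: big_nat_vanish_tail; first by lia.
  by move=> p lt_p; rewrite big_geq ?mulr0 //; lia.
- apply: big_nat_vanish_tail; first by lia.
  by move=> p lt_p; rewrite [X in _ * X]big_geq ?mulr0 //; lia.
rewrite (@big_nat_vanish_tail _ _ _ (n %/ 2).+1); first last.
- by move=> p lt_p; rewrite /h ifF ?mulr0 //; lia.
- by lia.
rewrite mulr_sumr; apply: eq_big_nat => p lt_p.
by rewrite /h ifT /g 1?mulrC //; lia.
Qed.
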